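(* Let $J\subseteq\Phi^+$ be closed and $A,B\in V_J$. Then either $\mathbb C\mathcal O_A^r\cong\mathbb C\mathcal O_B^r$ and $\mathbb C\mathcal O_A^l\cong\mathbb C\mathcal O_B^l$ (as right, respectively left, $\mathbb CU_J$-modules), or $\mathbb C\mathcal O_A^r,\mathbb C\mathcal O_B^r$ (respectively $\mathbb C\mathcal O_A^l,\mathbb C\mathcal O_B^l$) are disjoint, that is, the characters afforded by $\mathbb C\mathcal O_A^r$ and $\mathbb C\mathcal O_B^r$ (respectively by $\mathbb C\mathcal O_A^l$ and $\mathbb C\mathcal O_B^l$) are orthogonal.
   Context: $q$ is a prime power, $n\in\mathbb N$, $E$ the $n\times n$ identity matrix, $\Phi^+=\{(i,j)\mid 1\le i<j\le n\}$. $J\subseteq\Phi^+$ is closed if $(i,j),(j,k)\in J$ implies $(i,k)\in J$. $V_J=\{A\in M_n(q)\mid A_{ij}=0\text{ for }(i,j)\notin J\}$, and $U_J=\{E+A\mid A\in V_J\}$ is a group (pattern subgroup) acting on $V_J$ by left and right matrix multiplication. Fix a nontrivial character $\theta:(\mathbb F_q,+)\to\mathbb C^*$; for $A\in V_J$, $[A]$ is the linear character of $(V_J,+)$ given by $[A](B)=\theta(\sum_{(i,j)\in J}A_{ij}B_{ij})$; $\hat V_J=\{[A]\mid A\in V_J\}$. $U_J$ permutes $\hat V_J$ by $(\chi.u)(B)=\chi(Bu^{-1})$ and $(u.\chi)(B)=\chi(u^{-1}B)$. Put $\mathcal O_A^r=[A].U_J$, $\mathcal O_A^l=U_J.[A]$.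 Their $\mathbb C$-spans in $\mathbb C^{V_J}$ are $\mathbb CU_J$-modules via the monomial actions $\chi g=\chi(g^{-1}-E)\,(\chi.g)$ (right) and $g\chi=\chi(g^{-1}-E)\,(g.\chi)$ (left), $\chi\in\hat V_J$, $g\in U_J$. Two $\mathbb CG$-modules are disjoint if they have no irreducible constituent in common. *)

(* Defs.v *)
From HB Require Import structures.
From mathcomp Require Import all_boot all_order all_algebra fingroup.
From mathcomp Require Import mxrepresentation.

Set Implicit Arguments.
Unset Strict Implicit.
Unset Printing Implicit Defensive.

Import Order.TTheory GRing.Theory Num.Theory.
Local Open Scope ring_scope.

Definition Phi_plus n : {set 'I_n * 'I_n} := [set ij : 'I_n * 'I_n | (ij.1 < ij.2)%N].

Definition pclosed n (J : {set 'I_n * 'I_n}) : Prop :=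
  forall i j k, (i, j) \in J -> (j, k) \in J -> (i, k) \in J.

Record closed_pattern n := ClosedPattern {
  pattern :> {set 'I_n * 'I_n};
  pattern_sub : pattern \subset Phi_plus n;
  pattern_closed : pclosed pattern }.

Section Pattern.

Variables (F : finFieldType) (n : nat) (J : closed_pattern n).

Definition pmx : {pred 'M[F]_n} :=
  fun A => [forall i, forall j, ((i, j) \notin J) ==> (A i j == 0)].

Lemma pmxP (A : 'M[F]_n) :
  reflect (forall i j, (i, j) \notin J -> A i j = 0) (A \in pmx).
Proof.
apply: (iffP forallP) => [AJ i j nij | AJ i].
  by have /forallP/(_ j)/implyP/(_ nij)/eqP := AJ i.
by apply/forallP=> j; apply/implyP=> nij; rewrite AJ.
Qed.

Fact pmx_zmod_closed : zmod_closed pmx.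
Proof.
split=> [|A B /pmxP AJ /pmxP BJ]; apply/pmxP=> i j nij; first by rewrite mxE.
by rewrite !mxE AJ // BJ // subr0.
Qed.

HB.instance Definition _ :=
  GRing.isZmodClosed.Build 'M[F]_n pmx pmx_zmod_closed.

Lemma pmxM A B : A \in pmx -> B \in pmx -> A *m B \in pmx.
Proof.
move=> /pmxP AJ /pmxP BJ; apply/pmxP=> i k nik; rewrite mxE big1 // => j _.
have [ij|/AJ->] := boolP ((i, j) \in J); last by rewrite mul0r.
have [jk|/BJ->] := boolP ((j, k) \in J); last by rewrite mulr0.
by rewrite (pattern_closed ij jk) in nik.
Qed.

(* V_J *)
Record patV := PatV { patV_val :> 'M[F]_n; _ : patV_val \in pmx }.
HB.instance Definition _ := [isSub for patV_val].
HB.instance Definition _ := [Finite of patV by <:].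
HB.instance Definition _ := [SubChoice_isSubZmodule of patV by <:].

(* U_J = {E + A | A in V_J} *)
Record patU := PatU { patU_val :> 'M[F]_n; _ : patU_val - 1%:M \in pmx }.
HB.instance Definition _ := [isSub for patU_val].
HB.instance Definition _ := [Finite of patU by <:].

Implicit Types (u v : patU) (A B : patV).

Lemma mulVU_proof B u : val B *m val u \in pmx.
Proof.
rewrite -[val u](subrK 1%:M) mulmxDr mulmx1 rpredD ?pmxM ?(valP B) //.
exact: (valP u).
Qed.

Lemma mulUV_proof u B : val u *m val B \in pmx.
Proof.
rewrite -[val u](subrK 1%:M) mulmxDl mul1mx rpredD ?pmxM ?(valP B) //.
exact: (valP u).
Qed.

Definition mulVU B u : patV := PatV (mulVU_proof B u).
Definition mulUV u B : patV := PatV (mulUV_proof u B).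

Lemma patU1_proof : 1%:M - 1%:M \in pmx. Proof. by rewrite subrr rpred0. Qed.

Lemma patUM_proof u v : val u *m val v - 1%:M \in pmx.
Proof.
rewrite -[val v](subrK 1%:M) mulmxDr mulmx1 -addrA rpredD ?(valP u) //.
exact: (mulUV_proof u (PatV (valP v))).
Qed.

Lemma patU_unit u : val u \in unitmx.
Proof.
rewrite -unitmx_tr unitmxE det_trig.
  rewrite rpred_prod // => i _; rewrite mxE.
  have /pmxP/(_ i i) := valP u; rewrite !mxE eqxx => uii.
  suff /eqP : val u i i - 1%:R = 0 by rewrite subr_eq0 => /eqP->; rewrite unitr1.
  apply: uii; apply/negP=> /(subsetP (pattern_sub J)).
  by rewrite inE /= ltnn.
apply/is_trig_mxP=> i j ij; rewrite mxE.
have /pmxP/(_ j i) := valP u; rewrite !mxE.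
have -> : (j == i) = false by apply/negbTE; rewrite neq_ltn ij orbT.
rewrite subr0; apply; apply/negP=> /(subsetP (pattern_sub J)).
by rewrite inE /= ltnNge (ltnW ij).
Qed.

Lemma patUV_proof u : invmx (val u) - 1%:M \in pmx.
Proof.
pose f (v : patU) : patU := PatU (patUM_proof u v).
have f_inj : injective f.
  move=> v w /(congr1 val) /= /(congr1 (mulmx (invmx (val u)))).
  by rewrite !mulKmx ?patU_unit // => /val_inj.
have /codomP[v] : PatU patU1_proof \in codom f by apply/inj_card_onto.
move=> /(congr1 val) /= e.
have -> : invmx (val u) = val v.
  by rewrite -[RHS](mulKmx (patU_unit u)) -e mulmx1.
exact: (valP v).
Qed.

Definition patU1 : patU := PatU patU1_proof.
Definition patUM u v : patU := PatU (patUM_proof u v).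
Definition patUV u : patU := PatU (patUV_proof u).

Fact patUMA : associative patUM.
Proof. by move=> u v w; apply: val_inj; rewrite /= mulmxA. Qed.
Fact patU1M : left_id patU1 patUM.
Proof. by move=> u; apply: val_inj; rewrite /= mul1mx. Qed.
Fact patUVM : left_inverse patU1 patUV patUM.
Proof. by move=> u; apply: val_inj; rewrite /= mulVmx ?patU_unit. Qed.

HB.instance Definition _ := Finite_isGroup.Build patU patUMA patU1M patUVM.

(* u - E as an element of V_J *)
Definition subE u : patV := PatV (valP u).

End Pattern.

Section OrbitModules.

(* C stands for the complex numbers: the results are stated over an arbitrary
   numClosedFieldType, such as R[i] for R : rcfType, or algC. *)
Variables (F : finFieldType) (C : numClosedFieldType).

Record nontrivial_addchar := NontrivialAddchar {
  addchar :> F -> C;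
  addchar_neq0 : forall x, addchar x != 0;
  addcharD : forall x y, addchar (x + y) = addchar x * addchar y;
  addchar_nontrivial : exists x, addchar x != 1 }.

Variables (n : nat) (J : closed_pattern n) (theta : nontrivial_addchar).

Local Notation V := (patV F J).
Local Notation U := (patU F J).
Local Notation CV := {ffun V -> C^o}.
Implicit Types (A B : V) (u v g h : U) (chi psi : CV).

(* the linear character [A] of (V_J, +) *)
Definition lchar A : CV :=
  [ffun B : V => theta (\sum_(ij in pattern J) A ij.1 ij.2 * B ij.1 ij.2)].

(* chi.u and u.chi *)
Definition actr chi u : CV := [ffun B => chi (mulVU B u^-1%g)].
Definition actl u chi : CV := [ffun B => chi (mulUV u^-1%g B)].

(* the monomial actions chi g and g chi *)
Definition monr chi g : CV := chi (subE g^-1%g) *: actr chi g.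
Definition monl g chi : CV := chi (subE g^-1%g) *: actl g chi.

Definition orbr A : seq CV := undup [seq actr (lchar A) u | u : U].
Definition orbl A : seq CV := undup [seq actl u (lchar A) | u : U].

Definition linchar chi :=
  chi 0 = 1 /\ {morph chi : B B' / B + B' >-> B * B'}.

Lemma addchar0 : theta 0 = 1.
Proof.
by apply: (mulfI (addchar_neq0 theta 0)); rewrite -addcharD addr0 mulr1.
Qed.

Lemma linchar_lchar A : linchar (lchar A).
Proof.
split=> [|B B']; rewrite !ffunE.
  by rewrite big1 ?addchar0 // => ij _; rewrite mxE mulr0.
rewrite -addcharD -big_split; congr (theta _).
by apply: eq_bigr => ij _; rewrite mxE mulrDr.
Qed.

Lemma mulVUD u : {morph (fun B => mulVU B u) : B B' / B + B'}.
Proof. by move=> B B'; apply: val_inj; rewrite /= mulmxDl. Qed.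

Lemma mulUVD u : {morph mulUV u : B B' / B + B'}.
Proof. by move=> B B'; apply: val_inj; rewrite /= mulmxDr. Qed.

Lemma mul0VU u : mulVU 0 u = 0.
Proof. by apply: val_inj; rewrite /= mul0mx. Qed.

Lemma mulUV0 u : mulUV u 0 = 0.
Proof. by apply: val_inj; rewrite /= mulmx0. Qed.

Lemma linchar_actr chi u : linchar chi -> linchar (actr chi u).
Proof.
case=> chi0 chiD; split=> [|B B']; rewrite !ffunE ?mul0VU //.
by rewrite mulVUD chiD.
Qed.

Lemma linchar_actl chi u : linchar chi -> linchar (actl u chi).
Proof.
case=> chi0 chiD; split=> [|B B']; rewrite !ffunE ?mulUV0 //.
by rewrite mulUVD chiD.
Qed.

Lemma actrM chi u v : actr chi (u * v)%g = actr (actr chi u) v.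
Proof.
apply/ffunP=> B; rewrite !ffunE; congr (chi _); apply: val_inj.
by rewrite invMg /= mulmxA.
Qed.

Lemma actlM chi u v : actl (u * v)%g chi = actl u (actl v chi).
Proof.
apply/ffunP=> B; rewrite !ffunE; congr (chi _); apply: val_inj.
by rewrite invMg /= mulmxA.
Qed.

Lemma monr1 chi : linchar chi -> monr chi 1%g = chi.
Proof.
case=> chi0 _; rewrite /monr invg1.
have -> : subE 1%g = 0 :> V by apply: val_inj; rewrite /= subrr.
rewrite chi0 scale1r; apply/ffunP=> B; rewrite !ffunE invg1.
by congr (chi _); apply: val_inj; rewrite /= mulmx1.
Qed.

Lemma monl1 chi : linchar chi -> monl 1%g chi = chi.
Proof.
case=> chi0 _; rewrite /monl invg1.
have -> : subE 1%g = 0 :> V by apply: val_inj; rewrite /= subrr.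
rewrite chi0 scale1r; apply/ffunP=> B; rewrite !ffunE invg1.
by congr (chi _); apply: val_inj; rewrite /= mul1mx.
Qed.

Lemma monrM chi g h : linchar chi ->
  monr chi (g * h)%g = chi (subE g^-1%g) *: monr (actr chi g) h.
Proof.
case=> _ chiD; rewrite /monr scalerA actrM; congr (_ *: _).
rewrite ffunE -chiD; congr (chi _); apply: val_inj; rewrite invMg /=.
by rewrite mulmxBl mul1mx [RHS]addrC addrA subrK.
Qed.

Lemma monlM chi g h : linchar chi ->
  monl (g * h)%g chi = chi (subE h^-1%g) *: monl g (actl h chi).
Proof.
case=> _ chiD; rewrite /monl scalerA actlM; congr (_ *: _).
rewrite ffunE -chiD; congr (chi _); apply: val_inj; rewrite invMg /=.
by rewrite mulmxBr mulmx1 [RHS]addrC addrA subrK.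
Qed.

Lemma linchar_orthogonal chi psi : linchar chi -> linchar psi -> chi != psi ->
  \sum_B chi B * psi (- B) = 0.
Proof.
move=> [chi0 chiD] [psi0 psiD] /eqP neq; apply/eqP; apply: contraT => nz.
case: neq; apply/ffunP=> B0.
have psiK : psi B0 * psi (- B0) = 1 by rewrite -psiD subrr.
have e : chi B0 * psi (- B0) = 1.
  apply: (mulIf nz); rewrite mul1r [RHS](reindex_inj (addrI B0)) mulr_sumr.
  apply: eq_bigr => B _; rewrite opprD chiD psiD mulrACA //.
have nz0 : psi (- B0) != 0.
  by apply: contra_eq_neq psiK => ->; rewrite mulr0 eq_sym oner_eq0.
by apply: (mulIf nz0); rewrite e psiK.
Qed.

Lemma linchar_free (X : seq CV) :
  uniq X -> {in X, forall chi, linchar chi} -> free X.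
Proof.
move=> uX linX; apply/(@freeP _ _ _ (in_tuple X)) => k k0 i.
have lX (j : 'I_(size X)) : linchar X`_j by apply: linX; rewrite mem_nth.
have := congr1 (fun f : CV => \sum_B f B * (X`_i : CV) (- B)) k0.
rewrite [RHS]big1 => [|B _]; last by rewrite ffunE mul0r.
under eq_bigr => B _ do rewrite sum_ffunE mulr_suml.
rewrite exchange_big (bigD1 i) //= [X in _ + X]big1 => [|j ji]; last first.
  under eq_bigr => B _ do rewrite ffunE -mulrA.
  rewrite -mulr_sumr linchar_orthogonal ?mulr0 //.
  by rewrite nth_uniq // ?ltn_ord.
rewrite addr0.
under eq_bigr => B _.
  rewrite ffunE -mulrA -(proj2 (lX i)) subrr (proj1 (lX i)) mulr1; over.
rewrite sumr_const => /eqP; rewrite mulrn_eq0 => /orP[|/eqP //].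
by rewrite -leqn0 leqNgt; case/negP; apply/card_gt0P; exists 0.
Qed.

Lemma coord_nth (X : seq CV) (i j : 'I_(size X)) :
  free X -> coord (in_tuple X) i X`_j = (i == j)%:R.
Proof.
by move=> fX; rewrite (coord_free _ _ (fX : free (in_tuple X))) eq_sym.
Qed.

Lemma linchar_orbr A : {in orbr A, forall chi, linchar chi}.
Proof.
move=> chi; rewrite mem_undup => /imageP[u _ ->].
exact/linchar_actr/linchar_lchar.
Qed.

Lemma linchar_orbl A : {in orbl A, forall chi, linchar chi}.
Proof.
move=> chi; rewrite mem_undup => /imageP[u _ ->].
exact/linchar_actl/linchar_lchar.
Qed.

Lemma orbr_free A : free (orbr A).
Proof. by apply: linchar_free; [exact: undup_uniq | exact: linchar_orbr]. Qed.

Lemma orbl_free A : free (orbl A).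
Proof. by apply: linchar_free; [exact: undup_uniq | exact: linchar_orbl]. Qed.

Lemma orbr_closed A chi u : chi \in orbr A -> actr chi u \in orbr A.
Proof.
rewrite !mem_undup => /imageP[v _ ->]; rewrite -actrM.
by apply/imageP; exists (v * u)%g.
Qed.

Lemma orbl_closed A chi u : chi \in orbl A -> actl u chi \in orbl A.
Proof.
rewrite !mem_undup => /imageP[v _ ->]; rewrite -actlM.
by apply/imageP; exists (u * v)%g.
Qed.

Lemma monr_span A chi u : chi \in orbr A -> monr chi u \in <<orbr A>>%VS.
Proof. by move=> oX; rewrite memvZ // memv_span // orbr_closed. Qed.

Lemma monl_span A chi u : chi \in orbl A -> monl u chi \in <<orbl A>>%VS.
Proof. by move=> oX; rewrite memvZ // memv_span // orbl_closed. Qed.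

(* Matrix of g on the C-span of O_A^r, in the basis O_A^r (orbr_free): its
   i-th row holds the coordinates of (orbr A)`_i g, as right modules act on
   row vectors. *)
Definition rmodmx A g : 'M[C]_(size (orbr A)) :=
  \matrix_(i, j) coord (in_tuple (orbr A)) j (monr (orbr A)`_i g).

(* Dually, the j-th column holds the coordinates of g (orbl A)`_j: left modules
   act on column vectors, so this is again multiplicative in g. *)
Definition lmodmx A g : 'M[C]_(size (orbl A)) :=
  \matrix_(i, j) coord (in_tuple (orbl A)) i (monl g (orbl A)`_j).

Fact rmodmx_repr A : mx_repr [set: U] (rmodmx A).
Proof.
have lX (i : 'I_(size (orbr A))) : linchar (orbr A)`_i.
  by apply: (@linchar_orbr A); rewrite mem_nth.
split=> [|g h _ _]; apply/matrixP=> i j; rewrite !mxE.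
  rewrite monr1 //.
  by rewrite coord_nth ?orbr_free // eq_sym.
rewrite monrM // linearZ /=.
have gX : actr (orbr A)`_i g \in orbr A by rewrite orbr_closed ?mem_nth.
have [k Xk] : exists k : 'I_(size (orbr A)), actr (orbr A)`_i g = (orbr A)`_k.
  by case/(nthP 0): gX => k ltk <-; exists (Ordinal ltk).
have Mg l : coord (in_tuple (orbr A)) l (monr (orbr A)`_i g) =
    (orbr A)`_i (subE g^-1%g) * (l == k)%:R.
  by rewrite /monr Xk linearZ /= coord_nth ?orbr_free.
rewrite (bigD1 k) //= big1 => [|l lk]; rewrite !mxE Mg.
  by rewrite eqxx mulr1 addr0 Xk.
by rewrite (negPf lk) mulr0 mul0r.
Qed.

Fact lmodmx_repr A : mx_repr [set: U] (lmodmx A).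
Proof.
have lX (i : 'I_(size (orbl A))) : linchar (orbl A)`_i.
  by apply: (@linchar_orbl A); rewrite mem_nth.
split=> [|g h _ _]; apply/matrixP=> i j; rewrite !mxE.
  rewrite monl1 //.
  by rewrite coord_nth ?orbl_free.
rewrite monlM // linearZ /=.
have gX : actl h (orbl A)`_j \in orbl A by rewrite orbl_closed ?mem_nth.
have [k Xk] : exists k : 'I_(size (orbl A)), actl h (orbl A)`_j = (orbl A)`_k.
  by case/(nthP 0): gX => k ltk <-; exists (Ordinal ltk).
have Mh l : coord (in_tuple (orbl A)) l (monl h (orbl A)`_j) =
    (orbl A)`_j (subE h^-1%g) * (l == k)%:R.
  by rewrite /monl Xk linearZ /= coord_nth ?orbl_free.
rewrite (bigD1 k) //= big1 => [|l lk]; rewrite !mxE Mh.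
  by rewrite eqxx mulr1 addr0 Xk mulrC.
by rewrite (negPf lk) !mulr0.
Qed.

Definition rmod A := MxRepresentation (rmodmx_repr A).
Definition lmod A := MxRepresentation (lmodmx_repr A).

End OrbitModules.

Section Disjoint.

Variables (C : numClosedFieldType) (gT : finGroupType) (G : {group gT}).

(* Composition factors rather than submodules: this notion is the same whether
   the matrices act on rows or on columns. *)
Definition irr_constituent n (rG : mx_representation C G n)
    m (rS : mx_representation C G m) : Prop :=
  mx_irreducible rS /\
  exists (W1 W2 : 'M[C]_n) (modW1 : mxmodule rG W1) (modW2 : mxmodule rG W2),
    (W1 <= W2)%MS /\ mx_rsim rS (section_repr modW1 modW2).

Definition repr_disjoint n1 n2 (r1 : mx_representation C G n1)
    (r2 : mx_representation C G n2) : Prop :=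
  forall m (rS : mx_representation C G m),
    ~ (irr_constituent r1 rS /\ irr_constituent r2 rS).

Definition repr_char n (rG : mx_representation C G n) (g : gT) : C :=
  \tr (rG g).

Definition char_dot (phi psi : gT -> C) : C :=
  #|G|%:R^-1 * \sum_(g in G) phi g * (psi g)^*.

Definition char_orthogonal n1 n2 (r1 : mx_representation C G n1)
    (r2 : mx_representation C G n2) : Prop :=
  char_dot (repr_char r1) (repr_char r2) = 0.

End Disjoint.

(* Main.v *)
Require Import Defs.
From HB Require Import structures.
From mathcomp Require Import all_boot all_order all_algebra fingroup.
From mathcomp Require Import mxrepresentation.

Set Implicit Arguments.
Unset Strict Implicit.
Unset Printing Implicit Defensive.

Import Order.TTheory GRing.Theory Num.Theory.
Local Open Scope ring_scope.

(** The substitution u |-> u - E identifies the functions on V_J with those on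
    U_J, that is with the group algebra of U_J.  Under this identification the
    monomial actions on linear characters are the two translation actions of
    the regular bimodule (rreg_monr, lreg_monl), so they commute.

    Say that A and B are linked when [B] = u.[A].v for some u and v in U_J.
    If they are, left translation by u maps the span of O_A^r bijectively onto
    the span of O_B^r and commutes with right translations; symmetrically, right
    translation by v maps the span of O_A^l onto that of O_B^l.  So both pairs
    of modules are isomorphic (rmod_rsim, lmod_rsim).

    Otherwise, the span of the two-sided orbit of [A] and the span of all the
    other characters of V_J are stable under both translations, hence are
    two-sided ideals of the group algebra for the convolution conv; they meet
    trivially since distinct linear characters are linearly independent, so the
    product of an element of one by an element of the other is 0
    (conv_bistable0).  The characters of V_J add up to a multiple of the unit
    of the algebra (delta0_lchar); the part e of the unit that lies in the ideal
    of A therefore acts as 1 on this ideal and as 0 on that of B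
    (biorb_idempotent).

    Thus a single element of the group algebra acts as 1 on the modules of A and
    as 0 on those of B.  It acts in the same way on their composition factors,
    so they share none (gacts_as_disjoint); and there is no nonzero intertwiner
    between them, which yields the orthogonality of characters by the usual
    averaging argument of Schur (gacts_as_trace_orthogonal). *)

(** * Group algebra elements separating two representations *)

Section SeparatingElement.

Variables (C : numClosedFieldType) (gT : finGroupType).
Local Notation G := [set: gT].
Implicit Types (e : gT -> C) (c : C).

(** The element \sum_u e(u) u of the group algebra acts on rG as the scalar
    c. *)
Definition gacts_as e c n (rG : mx_representation C G n) : Prop :=
  \sum_u e u *: rG u = c%:M.

Lemma gacts_as_submod e c n (rG : mx_representation C G n) U
    (modU : mxmodule rG U) :
  gacts_as e c rG -> gacts_as e c (submod_repr modU).
Proof.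
move=> eG; rewrite /gacts_as /= /submod_mx.
under eq_bigr => u _ do rewrite -linearZ /= scalemxAr.
rewrite -linear_sum -mulmx_sumr eG mul_mx_scalar linearZ /= val_submodK.
by rewrite scalemx1.
Qed.

Lemma gacts_as_factmod e c n (rG : mx_representation C G n) U
    (modU : mxmodule rG U) :
  gacts_as e c rG -> gacts_as e c (factmod_repr modU).
Proof.
move=> eG; rewrite /gacts_as /= /factmod_mx.
under eq_bigr => u _ do rewrite -linearZ /= scalemxAr.
rewrite -linear_sum -mulmx_sumr eG mul_mx_scalar linearZ /= val_factmodK.
by rewrite scalemx1.
Qed.

Lemma gacts_as_rsim e c n m (rG : mx_representation C G n)
    (rS : mx_representation C G m) :
  mx_rsim rS rG -> gacts_as e c rG -> gacts_as e c rS.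
Proof.
case=> B _ freeB SBG eG; apply: (row_free_inj freeB) => /=.
rewrite mulmx_suml mul_scalar_mx -mul_mx_scalar -eG mulmx_sumr.
by apply: eq_bigr => u _; rewrite -scalemxAl SBG ?inE // scalemxAr.
Qed.

Lemma gacts_as_constituent e c n m (rG : mx_representation C G n)
    (rS : mx_representation C G m) :
  irr_constituent rG rS -> gacts_as e c rG -> gacts_as e c rS.
Proof.
case=> _ [W1 [W2 [mod1 [mod2 [_ simS]]]]] eG.
exact/(gacts_as_rsim simS)/gacts_as_submod/gacts_as_factmod.
Qed.

Variables (e : gT -> C) (n1 n2 : nat).
Variables (r1 : mx_representation C G n1) (r2 : mx_representation C G n2).
Hypotheses (e1 : gacts_as e 1 r1) (e2 : gacts_as e 0 r2).

Lemma gacts_as_disjoint : repr_disjoint r1 r2.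
Proof.
move=> m rS [irr1 irr2]; have [_ nz1 _] := irr1.1.
have := gacts_as_constituent irr1 e1.
rewrite /gacts_as (gacts_as_constituent irr2 e2) => /esym/eqP.
by rewrite raddf0 (negPf nz1).
Qed.

Lemma gacts_as_intertwiner (P : 'M_(n1, n2)) :
  (forall u, r1 u *m P = P *m r2 u) -> P = 0.
Proof.
move=> rP; rewrite -[P]mul1mx -e1 mulmx_suml.
under eq_bigr => u _ do rewrite -scalemxAl rP scalemxAr.
by rewrite -mulmx_sumr e2 raddf0 mulmx0.
Qed.

(** Averaging a matrix unit over the group produces an intertwiner, which has
    to be 0: this is the orthogonality of matrix coefficients. *)
Lemma gacts_as_trace_orthogonal :
  \sum_g repr_char r1 g * repr_char r2 g^-1%g = 0.
Proof.
have coef0 i j : \sum_g r1 g i i * r2 g^-1%g j j = 0.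
  pose P := \sum_g r1 g *m delta_mx i j *m r2 g^-1%g.
  have P0 : P = 0.
    apply: gacts_as_intertwiner => u.
    rewrite mulmx_sumr mulmx_suml (reindex_inj (mulgI u^-1%g)) /=.
    apply: eq_bigr => g _; rewrite !mulmxA -repr_mxM ?inE // mulKVg.
    by rewrite invMg invgK -[RHS]mulmxA -repr_mxM ?inE.
  transitivity (P i j); last by rewrite P0 mxE.
  rewrite summxE; apply: eq_bigr => g _.
  rewrite mxE (bigD1 j) //= big1 ?addr0 => [|k kj]; last first.
    rewrite mxE big1 ?mul0r // => l _.
    by rewrite mxE (negPf kj) andbF mulr0.
  rewrite mxE (bigD1 i) //= big1 ?addr0 => [|l li]; last first.
    by rewrite mxE (negPf li) mulr0.
  by rewrite mxE !eqxx mulr1.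
rewrite /repr_char /mxtrace.
under eq_bigr => g _ do rewrite mulr_suml.
rewrite exchange_big /= big1 // => i _.
under eq_bigr => g _ do rewrite mulr_sumr.
by rewrite exchange_big /= big1.
Qed.

Lemma gacts_as_char_orthogonal :
  (forall g, (repr_char r2 g)^* = repr_char r2 g^-1%g) ->
  char_orthogonal r1 r2.
Proof.
move=> r2J; rewrite /char_orthogonal /char_dot.
rewrite -[X in _ * X](_ : \sum_g repr_char r1 g * repr_char r2 g^-1%g = _).
  by rewrite gacts_as_trace_orthogonal mulr0.
by apply: eq_big => [g | g _]; rewrite ?inE // r2J.
Qed.

End SeparatingElement.

(** * Matrices of linear maps between spans of free families *)

Section LinearMatrices.

Variables (K : fieldType) (vT : vectType K).
Implicit Types (X Y Z : seq vT) (phi psi : {linear vT -> vT}).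

(** Matrix, acting on row vectors, of a linear map phi from the span of X to the
    span of Y; it is meaningful when X and Y are free and phi maps X into the
    span of Y. *)
Definition linmx X Y (phi : vT -> vT) : 'M[K]_(size X, size Y) :=
  \matrix_(i, j) coord (in_tuple Y) j (phi X`_i).

Lemma linmxM X Y Z phi psi :
  {in X, forall x, phi x \in <<Y>>%VS} ->
  linmx X Y phi *m linmx Y Z psi = linmx X Z (psi \o phi).
Proof.
move=> XY; apply/matrixP => i k; rewrite !mxE /=.
have Yi : phi X`_i \in <<in_tuple Y>>%VS by rewrite XY ?mem_nth.
rewrite [in RHS](coord_span Yi) !linear_sum /=.
by apply: eq_bigr => j _; rewrite !mxE !linearZ.
Qed.

Lemma linmx_scale X (phi : vT -> vT) c :
  free X -> {in X, forall x, phi x = c *: x} ->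
  linmx X X phi = c%:M.
Proof.
move=> fX phiX; apply/matrixP => i j; rewrite !mxE phiX ?mem_nth //.
rewrite linearZ /= (coord_free _ _ (fX : free (in_tuple X))).
by rewrite mulr_natr.
Qed.

Lemma linmx_id X phi psi : free X -> cancel phi psi ->
  linmx X X (psi \o phi) = 1%:M.
Proof.
by move=> fX phiK; apply: linmx_scale => // x _; rewrite /= phiK scale1r.
Qed.

Lemma linmx_sum (I : finType) X Y (a : I -> K) (phi : I -> vT -> vT) :
  linmx X Y (fun x => \sum_u a u *: phi u x) = \sum_u a u *: linmx X Y (phi u).
Proof.
apply/matrixP => i j; rewrite summxE !mxE linear_sum.
by apply: eq_bigr => u _; rewrite !mxE linearZ.
Qed.

Lemma coord_mem X (i : 'I_(size X)) y : free X -> y \in X ->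
  coord (in_tuple X) i y = (X`_i == y)%:R.
Proof.
move=> fX /(nthP 0)[k ltk <-].
rewrite (coord_free (Ordinal ltk) i (fX : free (in_tuple X))).
by rewrite nth_uniq ?free_uniq // eq_sym.
Qed.

Lemma span_stable X Y phi : {in X, forall x, phi x \in <<Y>>%VS} ->
  forall v, v \in <<X>>%VS -> phi v \in <<Y>>%VS.
Proof.
move=> XY v vX; rewrite (coord_span (vX : v \in <<in_tuple X>>%VS)).
rewrite linear_sum rpred_sum // => i _.
by rewrite linearZ rpredZ // XY ?mem_nth.
Qed.

End LinearMatrices.

(** * The group algebra of U_J on the functions on V_J *)

Section Biorbits.

Variables (F : finFieldType) (C : numClosedFieldType).
Variables (n : nat) (J : closed_pattern n).
Local Notation V := (patV F J).
Local Notation U := (patU F J).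
Local Notation CV := {ffun V -> C^o}.
Implicit Types (A B : V) (u v w g : U) (chi f h : CV).

(** The translations f |-> f(_ g^-1) and f |-> f(g^-1 _) of functions on U_J,
    transported to functions on V_J by u |-> u - E. *)
Definition rreg g f : CV := [ffun B => f (mulVU B g^-1%g + subE g^-1%g)].
Definition lreg g f : CV := [ffun B => f (mulUV g^-1%g B + subE g^-1%g)].

Fact rreg_linear g : linear (rreg g).
Proof. by move=> a f h; apply/ffunP => B; rewrite !ffunE. Qed.
Fact lreg_linear g : linear (lreg g).
Proof. by move=> a f h; apply/ffunP => B; rewrite !ffunE. Qed.

HB.instance Definition _ g :=
  GRing.isLinear.Build C CV CV *:%R (rreg g) (rreg_linear g).
HB.instance Definition _ g :=
  GRing.isLinear.Build C CV CV *:%R (lreg g) (lreg_linear g).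

Lemma subE_surj B : exists w, B = subE w.
Proof.
have BU : val B + 1%:M - 1%:M \in pmx J by rewrite addrK (valP B).
by exists (PatU BU); apply: val_inj; rewrite /= addrK.
Qed.

Lemma subE_inj : injective (@subE F n J).
Proof. by move=> u v /(congr1 val) /= /addIr /val_inj. Qed.

Lemma subE1 : subE 1%g = 0 :> V.
Proof. by apply: val_inj; rewrite /= subrr. Qed.

Lemma subE_mull u w : mulUV u (subE w) + subE u = subE (u * w)%g.
Proof. by apply: val_inj; rewrite /= mulmxBr mulmx1 addrA subrK. Qed.

Lemma subE_mulr u w : mulVU (subE w) u + subE u = subE (w * u)%g.
Proof. by apply: val_inj; rewrite /= mulmxBl mul1mx addrA subrK. Qed.

Lemma lreg_subE u f w : lreg u f (subE w) = f (subE (u^-1 * w)%g).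
Proof. by rewrite ffunE subE_mull. Qed.

Lemma rreg_subE u f w : rreg u f (subE w) = f (subE (w * u^-1)%g).
Proof. by rewrite ffunE subE_mulr. Qed.

Lemma subE_ext f h : (forall w, f (subE w) = h (subE w)) -> f = h.
Proof. by move=> fh; apply/ffunP => B; have [w ->] := subE_surj B. Qed.

Lemma lreg_rreg u v f : lreg u (rreg v f) = rreg v (lreg u f).
Proof.
by apply: subE_ext => w; rewrite lreg_subE !rreg_subE lreg_subE mulgA.
Qed.

Lemma lregVK u : cancel (lreg u) (lreg u^-1%g).
Proof. by move=> f; apply: subE_ext => w; rewrite !lreg_subE invgK mulKg. Qed.

Lemma rregVK u : cancel (rreg u) (rreg u^-1%g).
Proof. by move=> f; apply: subE_ext => w; rewrite !rreg_subE invgK mulgK. Qed.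

Lemma lregKV u : cancel (lreg u^-1%g) (lreg u).
Proof. by move=> f; have := lregVK u^-1%g f; rewrite invgK. Qed.

Lemma rregKV u : cancel (rreg u^-1%g) (rreg u).
Proof. by move=> f; have := rregVK u^-1%g f; rewrite invgK. Qed.

Lemma lreg1 f : lreg 1%g f = f.
Proof. by apply: subE_ext => w; rewrite lreg_subE invg1 mul1g. Qed.

Lemma rreg1 f : rreg 1%g f = f.
Proof. by apply: subE_ext => w; rewrite rreg_subE invg1 mulg1. Qed.

Lemma rreg_monr g chi : linchar chi -> rreg g chi = monr chi g.
Proof.
by case=> _ chiD; apply/ffunP => B; rewrite !ffunE chiD mulrC.
Qed.

Lemma lreg_monl g chi : linchar chi -> lreg g chi = monl g chi.
Proof.
by case=> _ chiD; apply/ffunP => B; rewrite !ffunE chiD mulrC.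
Qed.

(** The product of the group algebra of U_J, on functions on V_J. *)
Definition conv f h : CV := \sum_u f (subE u) *: lreg u h.

(** Left multiplication by f combines left translations, right multiplication
    by h combines right translations. *)
Lemma convE f h : conv f h = \sum_u h (subE u) *: rreg u f.
Proof.
apply: subE_ext => w; rewrite !sum_ffunE.
under eq_bigr => u _ do rewrite ffunE lreg_subE.
under [RHS]eq_bigr => u _ do rewrite ffunE rreg_subE.
rewrite (reindex_inj (inj_comp (mulgI w) invg_inj)) /=.
by apply: eq_bigr => u _; rewrite invMg invgK mulgKV; exact: mulrC.
Qed.

Lemma convDl f f' h : conv (f + f') h = conv f h + conv f' h.
Proof.
by rewrite -big_split; apply: eq_bigr => u _; rewrite ffunE scalerDl.
Qed.

Lemma convDr f h h' : conv f (h + h') = conv f h + conv f h'.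
Proof.
by rewrite -big_split; apply: eq_bigr => u _; rewrite linearD scalerDr.
Qed.

(** The unit of the group algebra: E in U_J is 0 in V_J. *)
Definition delta0 : CV := [ffun B => (B == 0)%:R].

Lemma delta0_subE w : delta0 (subE w) = (w == 1%g)%:R.
Proof. by rewrite ffunE -subE1 (inj_eq subE_inj). Qed.

Lemma conv_delta0 f : conv f delta0 = f.
Proof.
rewrite convE (bigD1 1%g) //= big1 => [|u /negPf nu]; rewrite delta0_subE.
  by rewrite eqxx scale1r rreg1 addr0.
by rewrite nu scale0r.
Qed.

Lemma delta0_conv f : conv delta0 f = f.
Proof.
rewrite /conv (bigD1 1%g) //= big1 => [|u /negPf nu]; rewrite delta0_subE.
  by rewrite eqxx scale1r lreg1 addr0.
by rewrite nu scale0r.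
Qed.

(** A family of linear characters of V_J that is stable under both actions of
    U_J. *)
Definition bistable (X : seq CV) :=
  {in X, forall chi, linchar chi} /\
  {in X, forall chi u, actl u chi \in X /\ actr chi u \in X}.

Section BistableSpan.

Variables (X : seq CV) (biX : bistable X).

Lemma lreg_bistable u f : f \in <<X>>%VS -> lreg u f \in <<X>>%VS.
Proof.
move=> fX; apply: (span_stable _ fX) => chi Xchi /=.
rewrite lreg_monl; last exact: biX.1.
by rewrite memvZ // memv_span // (biX.2 _ Xchi u).1.
Qed.

Lemma rreg_bistable u f : f \in <<X>>%VS -> rreg u f \in <<X>>%VS.
Proof.
move=> fX; apply: (span_stable _ fX) => chi Xchi /=.
rewrite rreg_monr; last exact: biX.1.
by rewrite memvZ // memv_span // (biX.2 _ Xchi u).2.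
Qed.

(** The span of a bistable family is a two-sided ideal. *)
Lemma conv_bistable_l f h : f \in <<X>>%VS -> conv f h \in <<X>>%VS.
Proof.
move=> fX; rewrite convE rpred_sum // => u _.
by rewrite rpredZ // rreg_bistable.
Qed.

Lemma conv_bistable_r f h : h \in <<X>>%VS -> conv f h \in <<X>>%VS.
Proof.
by move=> hX; rewrite rpred_sum // => u _; rewrite rpredZ // lreg_bistable.
Qed.

End BistableSpan.

(** The product lies in both ideals, and these meet trivially. *)
Lemma conv_bistable0 X Y : bistable X -> bistable Y -> uniq X -> uniq Y ->
    ~~ has (mem X) Y ->
  forall f h, f \in <<X>>%VS -> h \in <<Y>>%VS -> conv f h = 0.
Proof.
move=> biX biY uX uY XY f h fX hY.
have : free (X ++ Y).
  apply: linchar_free => [|chi]; first by rewrite cat_uniq uX XY.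
  by rewrite mem_cat => /orP[/biX.1 | /biY.1].
rewrite cat_free => /and3P[_ _ /directv_addP XY0].
apply/eqP; rewrite -memv0 -XY0 memv_cap.
by rewrite conv_bistable_l // conv_bistable_r.
Qed.

Lemma linchar_conj chi : linchar chi -> forall B, (chi B)^* = chi (- B).
Proof.
case=> chi0 chiD B.
have chiV B' : chi B' * chi (- B') = 1 by rewrite -chiD subrr.
have nz B' : chi B' != 0.
  by apply/eqP => z; move/eqP: (chiV B'); rewrite z mul0r eq_sym oner_eq0.
have : chi B ^+ #|{: V}| = 1.
  (* Translating by B the product of all the values of chi multiplies it by
     chi B to the power #|V_J|. *)
  have nzp : \prod_B' chi B' != 0 by apply/prodf_neq0 => B' _.
  apply: (mulIf nzp); rewrite mul1r [RHS](reindex_inj (addrI B)) /=.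
  under [RHS]eq_bigr => B' _ do rewrite chiD.
  by rewrite big_split prodr_const.
have V0 : (0 < #|{: V}|)%N by apply/card_gt0P; exists 0.
move/(congr1 Num.norm)/eqP; rewrite normrX normr1 pexpr_eq1 // => /eqP nB.
by apply: (mulfI (nz B)); rewrite -normCK nB expr1n chiV.
Qed.

(** * Two-sided orbits and their idempotents *)

Lemma actl_actr u v chi : actl u (actr chi v) = actr (actl u chi) v.
Proof.
apply/ffunP => B; rewrite !ffunE; congr (chi _).
by apply: val_inj; rewrite /= mulmxA.
Qed.

Lemma actr1 chi : actr chi 1%g = chi.
Proof.
apply/ffunP => B; rewrite ffunE invg1; congr (chi _).
by apply: val_inj; rewrite /= mulmx1.
Qed.

Lemma actl1 chi : actl 1%g chi = chi.
Proof.
apply/ffunP => B; rewrite ffunE invg1; congr (chi _).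
by apply: val_inj; rewrite /= mul1mx.
Qed.

Lemma actr_inj u : injective (fun chi => actr chi u).
Proof.
by apply: (can_inj (g := fun chi => actr chi u^-1%g)) => chi;
  rewrite -actrM mulgV actr1.
Qed.

Lemma actl_inj u : injective (fun chi => actl u chi).
Proof.
by apply: (can_inj (g := fun chi => actl u^-1%g chi)) => chi;
  rewrite -actlM mulVg actl1.
Qed.

Variable theta : nontrivial_addchar F C.

(** The two-sided orbit U_J.[A].U_J. *)
Definition biorb A : seq CV :=
  undup [seq actl w.1 (actr (lchar theta A) w.2) | w : U * U].

Lemma biorbP A chi :
  reflect (exists u v, chi = actl u (actr (lchar theta A) v)) (chi \in biorb A).
Proof.
rewrite mem_undup; apply: (iffP idP) => [/imageP[w _ ->] | [u [v ->]]].
  by exists w.1, w.2.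
by apply/imageP; exists (u, v).
Qed.

Lemma bistable_biorb A : bistable (biorb A).
Proof.
split=> [chi | chi] /biorbP[u [v ->]].
  exact/linchar_actl/linchar_actr/linchar_lchar.
move=> w; split; apply/biorbP.
  by exists (w * u)%g, v; rewrite actlM.
by exists u, (v * w)%g; rewrite actrM -actl_actr.
Qed.

Lemma orbr_biorb A : {subset orbr theta A <= biorb A}.
Proof.
move=> chi; rewrite mem_undup => /imageP[v _ ->].
by apply/biorbP; exists 1%g, v; rewrite actl1.
Qed.

Lemma orbl_biorb A : {subset orbl theta A <= biorb A}.
Proof.
move=> chi; rewrite mem_undup => /imageP[u _ ->].
by apply/biorbP; exists u, 1%g; rewrite actr1.
Qed.

Lemma lchar_biorb A : lchar theta A \in biorb A.
Proof. by apply/biorbP; exists 1%g, 1%g; rewrite actl1 actr1. Qed.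

Lemma lcharC A B : lchar theta A B = lchar theta B A.
Proof.
by rewrite !ffunE; congr (theta _); apply: eq_bigr => ij _; rewrite mulrC.
Qed.

Lemma lchar_nontrivial B : B != 0 -> exists A, lchar theta B A != 1.
Proof.
move=> nzB; have [x nx] := addchar_nontrivial theta.
have [[i j] Bij] : exists ij : 'I_n * 'I_n, val B ij.1 ij.2 != 0.
  apply/existsP; apply: contraR nzB => /existsPn B0; apply/eqP/val_inj.
  by apply/matrixP => i j; have := B0 (i, j); rewrite negbK mxE => /eqP.
have Jij : (i, j) \in pattern J.
  by apply: contraR Bij => nJ; rewrite (pmxP _ _ (valP B)).
have AJ : (x / val B i j) *: delta_mx i j \in pmx J.
  apply/pmxP => k l nJ; rewrite !mxE.
  case: (k =P i) nJ => [-> | _]; last by rewrite mulr0.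
  by case: (l =P j) => [-> | _]; rewrite ?Jij // mulr0.
(* The only nonzero entry of A is A_ij, chosen such that A_ij B_ij = x. *)
exists (PatV AJ); rewrite ffunE (bigD1 (i, j)) //= big1 ?addr0.
  by rewrite !mxE !eqxx mulr1 mulrC divfK.
move=> [k l] /andP[_ nkl]; rewrite !mxE /=.
by move: nkl; rewrite xpair_eqE => /negPf->; rewrite !mulr0.
Qed.

(** Orthogonality of characters on the group V_J. *)
Lemma delta0_lchar : delta0 = #|{: V}|%:R^-1 *: \sum_A lchar theta A.
Proof.
have nzV : #|{: V}|%:R != 0 :> C.
  by rewrite pnatr_eq0 -lt0n; apply/card_gt0P; exists 0.
apply/ffunP => B; rewrite ffunE ffunE sum_ffunE /=.
under eq_bigr => A _ do rewrite lcharC.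
case: eqP => [-> | /eqP/lchar_nontrivial[A nA]].
  under eq_bigr => A _ do rewrite lcharC (linchar_lchar theta A).1.
  by rewrite sumr_const; apply/esym/mulVf.
suff -> : \sum_A lchar theta B A = 0 by apply/esym/mulr0.
apply/eqP; apply: contraR nA => nz; apply/eqP/(mulIf nz).
rewrite mul1r [RHS](reindex_inj (addrI A)) mulr_sumr.
by apply: eq_bigr => B' _; rewrite (linchar_lchar theta B).2.
Qed.

(** The idempotent e is the component of the unit delta0 in the span of the
    two-sided orbit of [A]. *)
Lemma biorb_idempotent A B : lchar theta B \notin biorb A ->
  exists e : CV,
    {in biorb A, forall chi, conv chi e = chi /\ conv e chi = chi} /\
    {in biorb B, forall chi, conv chi e = 0 /\ conv e chi = 0}.
Proof.
move=> nAB; set X := biorb A.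
(* Y consists of all the characters of V_J outside the orbit X. *)
pose Y := undup (flatten
  [seq biorb D | D <- enum {: V} & lchar theta D \notin X]).
have YP chi : reflect (exists2 D, lchar theta D \notin X & chi \in biorb D)
                      (chi \in Y).
  rewrite mem_undup; apply: (iffP flatten_mapP) => [] [D].
    by rewrite mem_filter => /andP[nD _] Dchi; exists D.
  by move=> nD Dchi; exists D; rewrite // mem_filter nD mem_enum.
have biX : bistable X := bistable_biorb A.
have biY : bistable Y.
  split=> chi /YP[D nD Dchi]; first exact: (bistable_biorb D).1.
  move=> u; have [l r] := (bistable_biorb D).2 _ Dchi u.
  by split; apply/YP; exists D.
have XY : ~~ has (mem X) Y.
  apply/hasPn => chi /YP[D nD /biorbP[u [v Dchi]]]; apply: contra nD => /= Xchi.
  have := (biX.2 _ (biX.2 _ Xchi u^-1%g).1 v^-1%g).2.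
  by rewrite Dchi -actlM mulVg actl1 -actrM mulgV actr1.
have YX : ~~ has (mem Y) X by rewrite has_sym.
have uX : uniq X := undup_uniq _.
have uY : uniq Y := undup_uniq _.
pose k : C := #|{: V}|%:R^-1.
pose e : CV := k *: \sum_(D | lchar theta D \in X) lchar theta D.
pose r : CV := k *: \sum_(D | lchar theta D \notin X) lchar theta D.
have er : delta0 = e + r.
  by rewrite delta0_lchar (bigID (fun D => lchar theta D \in X)) scalerDr.
have eX : e \in <<X>>%VS by rewrite rpredZ // rpred_sum // => D /memv_span.
have rY : r \in <<Y>>%VS.
  rewrite rpredZ // rpred_sum // => D nD; apply/memv_span/YP.
  by exists D; rewrite ?lchar_biorb.
exists e; split=> chi Xchi.
  have sX := memv_span Xchi; split.
    rewrite -[RHS]conv_delta0 er convDr.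
    by rewrite (conv_bistable0 biX biY uX uY XY sX rY) addr0.
  rewrite -[RHS]delta0_conv er convDl.
  by rewrite (conv_bistable0 biY biX uY uX YX rY sX) addr0.
have sY : chi \in <<Y>>%VS by apply/memv_span/YP; exists B.
split; first exact: (conv_bistable0 biY biX uY uX YX sY eX).
exact: (conv_bistable0 biX biY uX uY XY eX sY).
Qed.

(** * The orbit modules *)

Lemma rmodE A g : rmod theta A g = linmx (orbr theta A) (orbr theta A) (rreg g).
Proof.
apply/matrixP => i j; rewrite !mxE rreg_monr //.
by apply: (@linchar_orbr _ _ _ _ theta A); rewrite mem_nth.
Qed.

Lemma lmodE A g :
  lmod theta A g = (linmx (orbl theta A) (orbl theta A) (lreg g))^T.
Proof.
apply/matrixP => i j; rewrite !mxE lreg_monl //.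
by apply: (@linchar_orbl _ _ _ _ theta A); rewrite mem_nth.
Qed.

Lemma rmod_acts_as A e c :
  {in orbr theta A, forall chi, conv chi e = c *: chi} ->
  gacts_as (fun u => e (subE u)) c (rmod theta A).
Proof.
move=> eA; rewrite /gacts_as; under eq_bigr => u _ do rewrite rmodE.
rewrite -linmx_sum; apply: linmx_scale => [|chi /eA <-]; first exact: orbr_free.
by rewrite convE.
Qed.

Lemma lmod_acts_as A e c :
  {in orbl theta A, forall chi, conv e chi = c *: chi} ->
  gacts_as (fun u => e (subE u)) c (lmod theta A).
Proof.
move=> eA; rewrite /gacts_as; under eq_bigr => u _ do rewrite lmodE -linearZ /=.
rewrite -linear_sum -linmx_sum (@linmx_scale _ _ _ _ c) //;
  last exact: orbl_free.
exact: tr_scalar_mx.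
Qed.

(** This gives the diagonal entries of the matrix of g^-1 as the conjugates of
    those of g. *)
Lemma linchar_fix_conjr chi g : linchar chi -> actr chi g = chi ->
  (chi (subE g^-1%g))^* = chi (subE g).
Proof.
move=> lchi fixg; rewrite linchar_conj // -[in RHS]fixg ffunE.
congr (chi _); apply: val_inj.
by rewrite /= mulmxBl mulmxV ?patU_unit // mul1mx opprB.
Qed.

Lemma linchar_fix_conjl chi g : linchar chi -> actl g chi = chi ->
  (chi (subE g^-1%g))^* = chi (subE g).
Proof.
move=> lchi fixg; rewrite linchar_conj // -[in RHS]fixg ffunE.
congr (chi _); apply: val_inj.
by rewrite /= mulmxBr mulVmx ?patU_unit // mulmx1 opprB.
Qed.

Lemma repr_char_rmod_conj A g :
  (repr_char (rmod theta A) g)^* = repr_char (rmod theta A) g^-1%g.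
Proof.
rewrite [LHS]rmorph_sum; apply: eq_bigr => i _; rewrite !mxE !linearZ /=.
set chi := (orbr theta A)`_i.
have Achi : chi \in orbr theta A by rewrite mem_nth.
have fA := orbr_free theta A.
rewrite !coord_mem ?orbr_closed // -/chi.
have -> : (chi == actr chi g^-1%g) = (chi == actr chi g).
  by rewrite -[LHS](inj_eq (@actr_inj g)) -actrM mulVg actr1 eq_sym.
case: eqP => [fixg | _]; last by rewrite /GRing.scale /= !mulr0 rmorph0.
rewrite /GRing.scale /= !mulr1 invgK linchar_fix_conjr //.
exact: linchar_orbr Achi.
Qed.

Lemma repr_char_lmod_conj A g :
  (repr_char (lmod theta A) g)^* = repr_char (lmod theta A) g^-1%g.
Proof.
rewrite [LHS]rmorph_sum; apply: eq_bigr => i _; rewrite !mxE !linearZ /=.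
set chi := (orbl theta A)`_i.
have Achi : chi \in orbl theta A by rewrite mem_nth.
have fA := orbl_free theta A.
rewrite !coord_mem ?orbl_closed // -/chi.
have -> : (chi == actl g^-1%g chi) = (chi == actl g chi).
  by rewrite -[LHS](inj_eq (@actl_inj g)) -actlM mulgV actl1 eq_sym.
case: eqP => [fixg | _]; last by rewrite /GRing.scale /= !mulr0 rmorph0.
rewrite /GRing.scale /= !mulr1 invgK linchar_fix_conjl //.
exact: linchar_orbl Achi.
Qed.

(** The isomorphism is left translation by u, with inverse left translation by
    u^-1. *)
Lemma rmod_rsim A B u v : lchar theta B = actl u (actr (lchar theta A) v) ->
  mx_rsim (rmod theta A) (rmod theta B).
Proof.
move=> eB; set X := orbr theta A; set Y := orbr theta B.
have XY : {in X, forall chi, lreg u chi \in <<Y>>%VS}.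
  move=> chi Xchi; rewrite lreg_monl; last exact: linchar_orbr Xchi.
  move: Xchi; rewrite mem_undup => /imageP[w _ ->].
  rewrite rpredZ // memv_span //.
  rewrite mem_undup; apply/imageP; exists (v^-1 * w)%g => //.
  by rewrite eB -!actl_actr -actrM mulKVg.
have YX : {in Y, forall chi, lreg u^-1%g chi \in <<X>>%VS}.
  move=> chi Ychi; rewrite lreg_monl; last exact: linchar_orbr Ychi.
  move: Ychi; rewrite mem_undup => /imageP[w _ ->].
  rewrite rpredZ // memv_span //.
  rewrite mem_undup; apply/imageP; exists (v * w)%g => //.
  by rewrite eB actl_actr -actlM mulVg actl1 actrM.
have [fX fY] : free X /\ free Y by split; apply: orbr_free.
have PQ : linmx X Y (lreg u) *m linmx Y X (lreg u^-1%g) = 1%:M.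
  by rewrite linmxM // linmx_id //; apply: lregVK.
have QP : linmx Y X (lreg u^-1%g) *m linmx X Y (lreg u) = 1%:M.
  by rewrite linmxM // linmx_id //; apply: lregKV.
apply: (@MxReprSim _ _ _ _ _ _ _ (linmx X Y (lreg u))).
- by apply/eqP; rewrite eqn_leq (mulmx1_min PQ) (mulmx1_min QP).
- by apply/row_freeP; exists (linmx Y X (lreg u^-1%g)).
move=> g _; rewrite !rmodE !linmxM //.
  by apply/matrixP => i j; rewrite !mxE /= lreg_rreg.
move=> chi Xchi /=; rewrite rreg_monr; last exact: linchar_orbr Xchi.
exact: monr_span.
Qed.

(** The isomorphism is right translation by v.  Left modules act on column
    vectors, hence the transposes, and the matrix that exhibits the similarity
    comes from the inverse translation, from the span of O_B^l to that of
    O_A^l. *)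
Lemma lmod_rsim A B u v : lchar theta B = actl u (actr (lchar theta A) v) ->
  mx_rsim (lmod theta A) (lmod theta B).
Proof.
move=> eB; set X := orbl theta A; set Y := orbl theta B.
have XY : {in X, forall chi, rreg v chi \in <<Y>>%VS}.
  move=> chi Xchi; rewrite rreg_monr; last exact: linchar_orbl Xchi.
  move: Xchi; rewrite mem_undup => /imageP[w _ ->].
  rewrite rpredZ // memv_span //.
  rewrite mem_undup; apply/imageP; exists (w * u^-1)%g => //.
  by rewrite eB -actlM mulgKV actl_actr.
have YX : {in Y, forall chi, rreg v^-1%g chi \in <<X>>%VS}.
  move=> chi Ychi; rewrite rreg_monr; last exact: linchar_orbl Ychi.
  move: Ychi; rewrite mem_undup => /imageP[w _ ->].
  rewrite rpredZ // memv_span //.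
  rewrite mem_undup; apply/imageP; exists (w * u)%g => //.
  by rewrite eB -!actl_actr -actrM mulgV actr1 actlM.
have [fX fY] : free X /\ free Y by split; apply: orbl_free.
have PQ : linmx X Y (rreg v) *m linmx Y X (rreg v^-1%g) = 1%:M.
  by rewrite linmxM // linmx_id //; apply: rregVK.
have QP : linmx Y X (rreg v^-1%g) *m linmx X Y (rreg v) = 1%:M.
  by rewrite linmxM // linmx_id //; apply: rregKV.
apply: (@MxReprSim _ _ _ _ _ _ _ (linmx Y X (rreg v^-1%g))^T).
- by apply/eqP; rewrite eqn_leq (mulmx1_min PQ) (mulmx1_min QP).
- by apply/row_freeP; exists (linmx X Y (rreg v))^T; rewrite -trmx_mul PQ trmx1.
move=> g _; rewrite !lmodE -!trmx_mul !linmxM //.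
  by apply/matrixP => i j; rewrite !mxE /= lreg_rreg.
move=> chi Ychi /=; rewrite lreg_monl; last exact: linchar_orbl Ychi.
exact: monl_span.
Qed.

End Biorbits.

Theorem lemma3p17 (F : finFieldType) (C : numClosedFieldType)
    (theta : nontrivial_addchar F C) (n : nat) (J : closed_pattern n)
    (A B : patV F J) :
  (mx_rsim (rmod theta A) (rmod theta B) /\
   mx_rsim (lmod theta A) (lmod theta B)) \/
  ((repr_disjoint (rmod theta A) (rmod theta B) /\
    char_orthogonal (rmod theta A) (rmod theta B)) /\
   (repr_disjoint (lmod theta A) (lmod theta B) /\
    char_orthogonal (lmod theta A) (lmod theta B))).
Proof.
have [/biorbP[u [v eB]] | nAB] := boolP (lchar theta B \in biorb theta A).
  by left; split; [apply: rmod_rsim eB | apply: lmod_rsim eB].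
right; have [e [eA eB]] := biorb_idempotent nAB.
have rA : gacts_as (fun u => e (subE u)) 1 (rmod theta A).
  by apply: rmod_acts_as => chi /orbr_biorb/eA[-> _]; rewrite scale1r.
have rB : gacts_as (fun u => e (subE u)) 0 (rmod theta B).
  by apply: rmod_acts_as => chi /orbr_biorb/eB[-> _]; rewrite scale0r.
have lA : gacts_as (fun u => e (subE u)) 1 (lmod theta A).
  by apply: lmod_acts_as => chi /orbl_biorb/eA[_ ->]; rewrite scale1r.
have lB : gacts_as (fun u => e (subE u)) 0 (lmod theta B).
  by apply: lmod_acts_as => chi /orbl_biorb/eB[_ ->]; rewrite scale0r.
split; split.
- exact: gacts_as_disjoint rA rB.
- exact: gacts_as_char_orthogonal rA rB (repr_char_rmod_conj theta B).
- exact: gacts_as_disjoint lA lB.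
- exact: gacts_as_char_orthogonal lA lB (repr_char_lmod_conj theta B).
Qed.
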